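(* For every pair of integers $a\ge1$ and $q\ge0$, $$Q_q^{(a)}(y)=\det(I-yC_q^{(a)}),\qquad P_q^{(a)}(y)=\mu_q^{(a)}\,\operatorname{adj}(I-yC_q^{(a)})\,\mathbf 1_{q+1}.$$ Equivalently (for the second formula), $$P_q^{(a)}(y)=\det\bigl(I-yC_q^{(a)}+\mathbf 1_{q+1}\mu_q^{(a)}\bigr)-\det\bigl(I-yC_q^{(a)}\bigr).$$ Moreover, $$Q_q^{(a)}(y)=\sum_{k=0}^{q+1}(-1)^{k(k+1)/2}\,y^k\sum_{\substack{S\subseteq\{0,\ldots,q\}\\ |S|=k,\ S\ q\text{-admissible}}}\ \prod_{s\in S}\binom{s+a-1}{a-1}.$$
   Context: For integers $a,m\ge1$ let $x=(x_{i,j})_{1\le i\le m,\,1\le j\le a}\in\mathbb R^{am}$ and $R_i=x_{i,1}+\cdots+x_{i,a}$. The path block polytope is $\mathcal P_m^{(a)}=\{x\in\mathbb R_{\ge0}^{am}: R_i+R_{i+1}\le1,\ 1\le i\le m-1\}$ for $m\ge2$, and $\mathcal P_1^{(a)}=\{x\in\mathbb R_{\ge0}^{a}:R_1\le1\}$. For integers $q\ge0$, $L_m^{(a)}(q)=\#(q\mathcal P_m^{(a)}\cap\mathbb Z^{am})$, and $\mathcal F_q^{(a)}(y)=\sum_{m\ge1}L_m^{(a)}(q)\,y^{m-1}$. Put $w_s^{(a)}=\binom{s+a-1}{a-1}$, let $\mu_q^{(a)}=(w_0^{(a)},\ldots,w_q^{(a)})$ (a row vector), let $C_q^{(a)}$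 be the $(q+1)\times(q+1)$ matrix indexed by $0\le r,s\le q$ with $(C_q^{(a)})_{r,s}=w_s^{(a)}$ if $r+s\le q$ and $0$ otherwise, and let $\mathbf 1_{q+1}$ be the all-one column vector of size $q+1$. $\operatorname{adj}$ denotes the adjugate matrix. The visible numerator $P_q^{(a)}(y)$ and visible denominator $Q_q^{(a)}(y)$ are defined by $\mathcal F_q^{(a)}(y)=P_q^{(a)}(y)/Q_q^{(a)}(y)$ with $Q_q^{(a)}(0)=1$, where ''visible'' means that $Q_q^{(a)}(y)$ is the determinant $\det(I-yC_q^{(a)})$ and $P_q^{(a)}(y)=Q_q^{(a)}(y)\mathcal F_q^{(a)}(y)$ is the corresponding numerator (no cancellation is performed). For $S=\{s_1<\cdots<s_k\}\subseteq\{0,1,\ldots,q\}$ put $\rho_i(S)=\#\{s_j\in S: s_i+s_j\le q\}$ for $1\le i\le k$. The set $S$ is called $q$-admissible if $\rho_i(S)=k+1-i$ for every $1\le i\le k$ (the empty set is $q$-admissible). *)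

(* Defs.v *)
From mathcomp Require Import all_boot all_order all_algebra finmap.
From mathcomp Require Import boolp classical_sets functions cardinality reals.

Import Order.TTheory GRing.Theory Num.Theory.
Local Open Scope ring_scope.

Section Polytope.
Local Open Scope classical_set_scope.
Variable R : realType.

(* A point of R^(am) is an m x a matrix, whose i-th row is block i. *)
Definition block_sum {m a : nat} (x : 'M[R]_(m, a)) (i : 'I_m) : R :=
  \sum_(j < a) x i j.

Definition path_block_polytope (a m : nat) : set 'M[R]_(m, a) :=
  [set x : 'M[R]_(m, a) | [/\ forall i j, 0 <= x i j,
               forall i i' : 'I_m, i' = i.+1 :> nat ->
                 block_sum x i + block_sum x i' <= 1
             & m = 1%N -> forall i, block_sum x i <= 1]].

Definition dilate {m a : nat} (q : nat) (A : set 'M[R]_(m, a)) : set 'M[R]_(m, a) :=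
  [set q%:R *: x | x in A].

Definition lattice (m a : nat) : set 'M[R]_(m, a) :=
  [set x : 'M[R]_(m, a) | forall i j, x i j \is a Num.int].

(* [fset_set] sends an infinite set to [fset0]; for m > 0 the polytope is
   bounded, so the set below is finite and this is its cardinality. *)
Definition lattice_count (a m q : nat) : nat :=
  #|` fset_set (dilate q (path_block_polytope a m) `&` lattice m a) |%fset.

End Polytope.

(* Formal power series in y, as sequences of coefficients. *)
Definition fps := nat -> int.

Definition fps_of_poly (p : {poly int}) : fps := fun n => p`_n.

Definition fps_mul (f g : fps) : fps :=
  fun n => \sum_(i < n.+1) f i * g (n - i)%N.

Definition path_series (R : realType) (a q : nat) : fps :=
  fun n => (lattice_count R a n.+1 q)%:Z.

Definition block_weight (a s : nat) : nat := 'C(s + a - 1, a - 1).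

Definition weight_row (a q : nat) : 'rV[int]_q.+1 :=
  \row_(s < q.+1) (block_weight a s)%:Z.

Definition transfer_mx (a q : nat) : 'M[int]_q.+1 :=
  \matrix_(r < q.+1, s < q.+1)
    if (r + s <= q)%N then (block_weight a s)%:Z else 0.

(* I - y C, with y the polynomial variable 'X *)
Definition char_transfer_mx (a q : nat) : 'M[{poly int}]_q.+1 :=
  1%:M - 'X *: map_mx polyC (transfer_mx a q).

Definition weight_row_poly (a q : nat) : 'rV[{poly int}]_q.+1 :=
  map_mx polyC (weight_row a q).

Definition ones_col (q : nat) : 'cV[{poly int}]_q.+1 := const_mx 1.

Definition visible_denominator (a q : nat) : {poly int} :=
  \det (char_transfer_mx a q).

Lemma visible_denominator0 (a q : nat) : (visible_denominator a q).[0] = 1.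
Proof.
rewrite /visible_denominator -horner_evalE -det_map_mx -[RHS](@det1 _ q.+1).
congr (\det _); apply/matrixP => i j.
rewrite !mxE /= horner_evalE hornerD hornerN hornerM hornerX mul0r subr0.
by rewrite hornerMn hornerC.
Qed.

(* A priori only a power series; since the denominator has constant term 1,
   this defines the numerator by path_series = numerator / denominator. *)
Definition visible_numerator (R : realType) (a q : nat) : fps :=
  fps_mul (fps_of_poly (visible_denominator a q)) (path_series R a q).

(* The enumeration of a set of ordinals is increasing, so [enum_val i] is the
   (i+1)-st smallest element of S. *)
Definition rho {q : nat} (S : {set 'I_q.+1}) (i : 'I_#|S|) : nat :=
  #|[set t in S | (enum_val i + t <= q)%N]|.

(* rho_i(S) = k + 1 - i, with i the 1-based index i.+1. *)
Definition admissible {q : nat} (S : {set 'I_q.+1}) : bool :=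
  [forall i : 'I_#|S|, rho S i == (#|S| + 1 - i.+1)%N].

(* Main.v *)
Require Import Defs.
From mathcomp Require Import all_boot all_order all_algebra perm finmap.
From mathcomp Require Import boolp classical_sets functions cardinality reals.

Import Order.TTheory GRing.Theory Num.Theory.
Local Open Scope ring_scope.

(** Lattice points of the dilated polytope are walks of block vectors whose
    consecutive block sums add up to at most q.  There are w_s block vectors of
    sum s, so L_m(q) = mu C^(m-1) 1, and expanding (I - yC)^-1 through the
    adjugate gives the numerator.  The determinant det(I - yC) is the sum over
    S of (-y)^|S| times the principal minor of C on S.  That minor is the product
    of the weights times the determinant of the 0/1 matrix [s_i + s_j <= q], which
    is a Ferrers matrix with row lengths rho_i(S): it is singular unless these
    lengths are k, k-1, ..., 1, and then it is the antitriangular staircase. *)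

(** * Principal minors, Ferrers determinants and rank-one updates *)

Lemma det_mxsub_perm (R : comNzRingType) (n : nat) (f : 'I_n -> 'I_n)
  (A : 'M[R]_n) : injective f -> \det (mxsub f f A) = \det A.
Proof.
move=> f_inj; have -> : mxsub f f A = row_perm (perm f_inj) (col_perm (perm f_inj) A).
  by apply/matrixP => i j; rewrite !mxE !permE.
rewrite row_permE col_permE !det_mulmx !det_perm odd_permV mulrCA -expr2.
by rewrite sqrr_sign mulr1.
Qed.

(** Induction on [n]: expanding along an identity row outside the image of [f] deletes that row and
    its column. Once [f] is onto, it only permutes the indices. *)
Lemma det_identity_rows (R : comNzRingType) (k n : nat) (f : 'I_k -> 'I_n)
    (A : 'M[R]_n) :
    injective f ->
    (forall i j, i \notin codom f -> A i j = (i == j)%:R) ->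
  \det A = \det (mxsub f f A).
Proof.
elim: n f A => [|n IHn] f A f_inj A1.
  case: k f f_inj A1 => [|k] f f_inj A1; last by case: (f ord0).
  by rewrite !det_mx00.
have [i iNf|f_onto] := pickP [pred i | i \notin codom f]; last first.
  have kn : k = n.+1.
    have := card_codom f_inj; rewrite card_ord => <-.
    rewrite -[RHS]card_ord; apply: eq_card => i; rewrite inE.
    by have /negbFE := f_onto i.
  by case: _ / kn A f f_inj A1 {f_onto} => A f f_inj _; rewrite det_mxsub_perm.
have fNi j : i != f j by apply: contra iNf => /eqP->; rewrite codom_f.
have Ai j : A i j = (i == j)%:R by exact: A1.
rewrite (expand_det_row _ i) (bigD1 i) //= big1 => [|j ji]; last first.
  by rewrite Ai eq_sym (negPf ji) mul0r.
rewrite Ai eqxx mul1r addr0 /cofactor -signr_odd addnn odd_double expr0 mul1r.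
(* [g] is [f] read in the index set with [i] removed. *)
pose g j := s2val (unlift_some (fNi j)).
have gE j : lift i (g j) = f j by rewrite /g; case: (unlift_some _).
have g_inj : injective g by move=> j j' /(congr1 (lift i)); rewrite !gE => /f_inj.
rewrite (IHn g) //; last first.
  move=> r s rNg; rewrite !mxE A1 ?(inj_eq lift_inj) //.
  apply: contra rNg => /codomP[j]; rewrite -gE => /lift_inj->; exact: codom_f.
by congr (\det _); apply/matrixP => r s; rewrite !mxE !gE.
Qed.

(* Expand each row of 1 + A as the sum of a row of 1 and a row of A. *)
Lemma det_add1_minors (R : comNzRingType) (n : nat) (A : 'M[R]_n) :
  \det (1%:M + A) =
    \sum_(S : {set 'I_n}) \det (mxsub (@enum_val _ (mem S)) (@enum_val _ (mem S)) A).
Proof.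
transitivity (\sum_(S : {set 'I_n})
    \det (\matrix_(i, j) (if i \in S then A i j else (i == j)%:R))).
  rewrite /determinant exchange_big /=; apply: eq_bigr => s _.
  rewrite -mulr_sumr; congr (_ * _).
  under eq_bigr do rewrite !mxE addrC.
  rewrite bigA_distr; apply: eq_bigr => S _; apply: eq_bigr => i _.
  by rewrite !mxE.
apply: eq_bigr => S _.
rewrite (@det_identity_rows _ _ _ (@enum_val _ (mem S))).
- by congr (\det _); apply/matrixP => i j; rewrite !mxE enum_valP.
- exact: enum_val_inj.
move=> i j iNS; rewrite !mxE; case: ifP => // iS; case/negP: iNS.
by apply/codomP; exists (enum_rank_in iS i); rewrite enum_rankK_in.
Qed.

(** The last row meets the staircase only in column 0; removing both leaves the next smaller
    staircase. The cofactor signs accumulate to the exponent 0 + 1 + ... + (k - 1). *)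
Lemma det_staircase (R : comNzRingType) (k : nat) :
  \det (\matrix_(i < k, j < k) (i + j < k)%N%:R) = (-1) ^+ (k * k.-1 %/ 2) :> R.
Proof.
elim: k => [|k IHk]; first by rewrite det_mx00.
rewrite (expand_det_row _ ord_max) (bigD1 ord0) //= big1 => [|j]; last first.
  rewrite -val_eqE /= -lt0n => j_gt0.
  by rewrite !mxE /= ltnS leqNgt -{1}[k]addn0 ltn_add2l j_gt0 mul0r.
rewrite !mxE /= !addn0 ltnSn mul1r /cofactor /= addn0.
rewrite [X in _ * \det X](_ : _ = \matrix_(i < k, j < k) (i + j < k)%N%:R).
  rewrite IHk -exprD addr0; congr (_ ^+ _).
  by rewrite !divn2 -bin2 -[k in RHS]/k.+1.-1 -bin2 binS bin1 addnC.
by apply/matrixP => i j; rewrite !mxE lift_max lift0 addnS ltnS.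
Qed.

(** Descending from [r 0 <= k] bounds [r i] above by [k - i]; climbing back from a positive last
    value bounds it below by the same number. *)
Lemma strict_antitone_staircase (k : nat) (r : 'I_k -> nat) :
    (forall i j : 'I_k, (i < j)%N -> (r j < r i)%N) ->
    (forall i, 0 < r i <= k)%N ->
  forall i, r i = (k - i)%N.
Proof.
move=> r_anti r_bnd i.
have up n (j : 'I_k) : j = n :> nat -> (r j + n <= k)%N.
  elim: n j => [|n IHn] j jn; first by rewrite addn0; have /andP[] := r_bnd j.
  have nk : (n < k)%N by rewrite ltnW // -jn.
  rewrite addnS (leq_trans _ (IHn (Ordinal nk) erefl)) //.
  by rewrite ltn_add2r r_anti // jn.
have low n (j : 'I_k) : (j + n.+1)%N = k -> (n < r j)%N.
  elim: n j => [|n IHn] j jn; first by have /andP[] := r_bnd j.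
  have jk : (j.+1 < k)%N by rewrite -[ltnRHS]jn !addnS !ltnS leq_addr.
  by apply: leq_ltn_trans (r_anti j (Ordinal jk) _) => //; apply: IHn; rewrite /= addSnnS.
have ik : (0 < k - i)%N by rewrite subn_gt0.
have lo : ((k - i).-1 < r i)%N by apply: low; rewrite prednK // subnKC // ltnW.
apply/eqP; rewrite eqn_leq -{2}(prednK ik) lo andbT leq_subRL; last exact: ltnW.
by rewrite addnC up.
Qed.

Lemma det_ferrers (R : comNzRingType) (k : nat) (r : 'I_k -> nat) :
    (forall i j : 'I_k, (i <= j)%N -> (r j <= r i)%N) ->
    (forall i, r i <= k)%N ->
  \det (\matrix_(i < k, j < k) (j < r i)%N%:R) =
    if [forall i : 'I_k, r i == (k - i)%N] then (-1) ^+ (k * k.-1 %/ 2) else 0 :> R.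
Proof.
move=> r_anti r_le; case: ifP => [/forallP rE|/negbT rN].
  rewrite -det_staircase; congr (\det _); apply/matrixP => i j.
  by rewrite !mxE (eqP (rE i)) ltn_subRL.
(* Either some row vanishes, or two rows coincide, or r is strictly decreasing
   and positive, which forces the staircase. *)
have [i /eqP ri|r_gt0] := pickP [pred i | r i == 0%N].
  rewrite (expand_det_row _ i) big1 // => j _; rewrite !mxE.
  by have -> : r i = 0%N by []; rewrite ltn0 mul0r.
have [[i j] /andP[/= ij /eqP rij]|r_inj] :=
  pickP [pred p : 'I_k * 'I_k | (p.1 != p.2) && (r p.1 == r p.2)].
  by apply: (determinant_alternate ij) => s; rewrite !mxE rij.
case/negP: rN; apply/forallP => i; apply/eqP.
apply: strict_antitone_staircase => [{}i j ij|{}i].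
  rewrite ltn_neqAle r_anti ?(ltnW ij) // andbT.
  have := r_inj (i, j); rewrite /= eq_sym (eq_sym (r i)).
  by rewrite -val_eqE /= gtn_eqF //= => ->.
by rewrite r_le andbT lt0n; have /= -> := r_gt0 i.
Qed.

(* Both sides are the determinant of the bordered matrix [[A, -u], [v, 1]]. *)
Lemma det_add_rank1 (R : idomainType) (n : nat) (A : 'M[R]_n)
    (u : 'cV[R]_n) (v : 'rV[R]_n) : \det A != 0 ->
  \det (A + u *m v) = \det A + (v *m \adj A *m u) ord0 ord0.
Proof.
move=> dA; pose B := block_mx A (- u) v 1%:M.
have -> : \det (A + u *m v) = \det B.
  have: B *m block_mx 1%:M 0 (- v) 1%:M = block_mx (A + u *m v) (- u) 0 1%:M.
    rewrite mulmx_block !mulmx1 !mul1mx !mulmx0 !add0r mulNmx mulmxN opprK.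
    by rewrite subrr.
  move/(congr1 determinant); rewrite det_mulmx det_lblock det_ublock !det1.
  by rewrite !mulr1.
(* Eliminating [v] with the adjugate in place of the inverse stays over [R] but scales the
   determinant by [\det A], a factor to be cancelled. *)
apply: (mulfI dA).
have: block_mx 1%:M 0 (- v *m \adj A) (\det A)%:M *m B =
      block_mx A (- u) 0 (v *m \adj A *m u + (\det A)%:M).
  rewrite mulmx_block !mul0mx !mul1mx !addr0 mulmx1 -mulmxA mul_adj_mx.
  rewrite mul_mx_scalar mul_scalar_mx scalerN addNr.
  by rewrite !(mulNmx, mulmxN) opprK.
move/(congr1 determinant); rewrite det_mulmx det_lblock det_ublock det1 mul1r.
by rewrite det_scalar1 => ->; rewrite det_mx11 !mxE eqxx mulr1n addrC.
Qed.

(** * Block vectors and walks counted by the transfer matrix *)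

Definition block_size {a q : nat} (u : a.-tuple 'I_q.+1) : nat :=
  (\sum_(j <- u) j)%N.

Definition block_adj {a q : nat} : rel (a.-tuple 'I_q.+1) :=
  fun u v => (block_size u + block_size v <= q)%N.

(** Stars and bars: entries of a vector of sum [s] are at most [s], so bounding them by [q] instead
    of [s] changes nothing. *)
Lemma card_block_size (a q s : nat) : (0 < a)%N -> (s <= q)%N ->
  #|[set u : a.-tuple 'I_q.+1 | block_size u == s]| = block_weight a s.
Proof.
case: a => // a _ sq; rewrite /block_weight !subn1 addnS /= addnC.
rewrite -card_ord_partitions.
pose h := widen_ord (m := q.+1) (n := s.+1) sq.
have h_inj : injective (fun t : a.+1.-tuple 'I_s.+1 => map_tuple h t).
  by move=> t t' /(congr1 val) /inj_map /val_inj; apply => x y /(congr1 val) /= xy; exact: val_inj.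
rewrite -(card_imset _ h_inj); apply: eq_card => u; rewrite inE.
apply/eqP/imsetP => [us|[t]]; last first.
  by rewrite inE => /eqP ts ->; rewrite /block_size big_map -[RHS]ts.
have u_le j : (tnth u j <= s)%N.
  by rewrite -us /block_size big_tuple (bigD1 j) //= leq_addr.
exists (map_tuple (fun x : 'I_q.+1 => inord x : 'I_s.+1) u).
  rewrite inE big_map big_tuple -[X in _ == X]us /block_size big_tuple.
  by apply/eqP; apply: eq_bigr => j _; rewrite inordK // ltnS.
by apply: eq_from_tnth => j; rewrite !tnth_map; apply: val_inj; rewrite /= inordK // ltnS.
Qed.

Lemma sum_tupleS (T : finType) (n : nat) (F : n.+1.-tuple T -> nat) :
  (\sum_t F t = \sum_x \sum_(t : n.-tuple T) F (cons_tuple x t))%N.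
Proof.
rewrite pair_bigA (reindex (fun p : T * n.-tuple T => cons_tuple p.1 p.2)) //=.
exists (fun t : n.+1.-tuple T => (thead t, behead_tuple t)) => [[x t] _|t _] /=.
  by congr (_, _); apply: val_inj.
by rewrite [t in RHS]tuple_eta; apply: val_inj.
Qed.

(** Adjacency sees only block sums. Grouping the choices of the next vector by its sum [s] gives
    [block_weight a s] equal contributions, which is one multiplication by the transfer matrix. *)
Lemma card_block_path (a q n : nat) (u : a.-tuple 'I_q.+1) (r : 'I_q.+1) :
    (0 < a)%N -> block_size u = r ->
  #|[set t : n.-tuple (a.-tuple 'I_q.+1) | path block_adj u t]|%:Z =
    (transfer_mx a q ^+ n *m (const_mx 1 : 'cV_q.+1)) r ord0.
Proof.
move=> a_gt0; elim: n u r => [|n IHn] u r ur.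
  rewrite expr0 mul1mx !mxE (_ : [set _ | _] = finset.setT) ?cardsT ?card_tuple //.
  by apply/setP => t; rewrite !inE tuple0.
rewrite -sum1dep_card big_mkcond /= sum_tupleS /=.
rewrite exprS -mulmxA !mxE.
transitivity (\sum_(v : a.-tuple 'I_q.+1 | (r + block_size v <= q)%N)
    (transfer_mx a q ^+ n *m (const_mx 1 : 'cV_q.+1)) (inord (block_size v)) ord0).
  rewrite [RHS]big_mkcond -[LHS]natz natr_sum; apply: eq_bigr => v _ /=; rewrite natz.
  rewrite {1}/block_adj ur; case: ifP => rv /=; last by rewrite big1.
  have vq : (block_size v <= q)%N by rewrite (leq_trans _ rv) ?leq_addl.
  rewrite -(IHn v) ?inordK //.
  by rewrite -sum1dep_card [in RHS]big_mkcond.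
rewrite (partition_big (fun v => inord (block_size v) : 'I_q.+1) xpredT) //=.
apply: eq_bigr => s _; rewrite [in RHS]mxE.
rewrite (eq_bigr (fun=> (transfer_mx a q ^+ n *m (const_mx 1 : 'cV_q.+1)) s ord0)); last first.
  by move=> v /andP[_ /eqP->].
rewrite sumr_const -[LHS]mulr_natl; case: ifP => rs.
  rewrite -(@card_block_size a q s) //; last by rewrite -ltnS.
  congr (_ * _); rewrite natz; congr (Posz _); rewrite -[RHS]sum1dep_card -sum1_card.
  apply: eq_bigl => v; rewrite unfold_in; apply/andP/eqP => [[rv /eqP <-]|vs].
    by rewrite inordK // ltnS (leq_trans _ rv) ?leq_addl.
  by rewrite vs rs; split=> //; apply/eqP/val_inj; rewrite /= inordK.
rewrite eq_card0 ?mul0r // => v; rewrite unfold_in; apply/negP => /andP[rv /eqP vs].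
by move: rs; rewrite -vs inordK ?rv // ltnS (leq_trans _ rv) ?leq_addl.
Qed.

(* Starting the walk at the zero vector bounds the first block sum by q; this
   matters only for m = 1, where the polytope has the extra constraint R_1 <= 1. *)
Lemma block_pathP (a q m : nat) (t : m.+1.-tuple (a.-tuple 'I_q.+1)) :
  reflect
    ((forall i i' : 'I_m.+1, i' = i.+1 :> nat ->
        block_size (tnth t i) + block_size (tnth t i') <= q)%N /\
     (m.+1 = 1%N -> forall i, block_size (tnth t i) <= q)%N)
    (path block_adj (nseq_tuple a ord0) t).
Proof.
pose z : a.-tuple 'I_q.+1 := nseq_tuple a ord0.
have z0 : block_size z = 0%N.
  by rewrite /block_size big_tuple big1 // => j _; rewrite tnth_nseq.
apply: (iffP (pathP z)); rewrite size_tuple; [move=> t_adj|move=> [t_adj t1] [|i] im].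
- split=> [i i' ii'|[m0] i].
    by have := t_adj _ (ltn_ord i'); rewrite /block_adj !(tnth_nth z) ii'.
  have i0 : i = 0%N :> nat by case: i => -[|i] //=; rewrite m0.
  by have := t_adj i (ltn_ord i); rewrite /block_adj (tnth_nth z) {1}i0 /= z0.
- rewrite /block_adj z0 add0n /= -[X in block_size X](tnth_nth z t ord0).
  case: m t t_adj t1 im => [|m] t t_adj t1 _; first exact: t1.
  by apply: leq_trans (t_adj ord0 (lift ord0 ord0) erefl); rewrite leq_addr.
- have im' : (i < m.+1)%N := ltnW im.
  by have := t_adj (Ordinal im') (Ordinal im) erefl; rewrite !(tnth_nth z).
Qed.

(** * Lattice points of the dilated polytope as walks *)

Definition block_mx_of (R : realType) {a m q : nat}
    (t : m.-tuple (a.-tuple 'I_q.+1)) : 'M[R]_(m, a) :=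
  \matrix_(i, j) (tnth (tnth t i) j)%:R.

Lemma block_mx_of_inj (R : realType) (a m q : nat) :
  injective (@block_mx_of R a m q).
Proof.
move=> t t' /matrixP tt'; apply: eq_from_tnth => i; apply: eq_from_tnth => j.
by apply: val_inj; have /eqP := tt' i j; rewrite !mxE eqr_nat => /eqP.
Qed.

Lemma block_sum_mx_of (R : realType) (a m q : nat)
    (t : m.-tuple (a.-tuple 'I_q.+1)) (i : 'I_m) :
  block_sum R (block_mx_of R t) i = (block_size (tnth t i))%:R.
Proof.
rewrite /block_sum /block_size big_tuple raddf_sum.
by apply: eq_bigr => j _; rewrite mxE.
Qed.

Lemma block_sumZ (R : realType) (a m : nat) (c : R) (x : 'M[R]_(m, a)) (i : 'I_m) :
  block_sum R (c *: x) i = c * block_sum R x i.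
Proof. by rewrite /block_sum mulr_sumr; apply: eq_bigr => j _; rewrite mxE. Qed.

Lemma dilate_path_block_polytopeP (R : realType) (a m q : nat)
    (t : m.+1.-tuple (a.-tuple 'I_q.+1)) :
  dilate R q (path_block_polytope R a m.+1) (block_mx_of R t) <->
  path block_adj (nseq_tuple a ord0) t.
Proof.
split=> [[y [_ yadj y1] yt]|/block_pathP[tadj t1]].
  have ysum i : (block_size (tnth t i))%:R = q%:R * block_sum R y i.
    by rewrite -(block_sum_mx_of R) -yt block_sumZ.
  apply/block_pathP; split=> [i i' ii'|m1 i]; rewrite -(ler_nat R) ?natrD !ysum.
    by rewrite -mulrDr ler_piMr // yadj.
  by rewrite ler_piMr // y1.
(* Only an inequality, so that [q = 0], where the inverse is 0 by convention, is covered too. *)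
have q1 : q%:R^-1 * q%:R <= 1 :> R.
  by have [->|q0] := eqVneq (q%:R : R) 0; rewrite ?mulr0 ?mulVf.
exists (q%:R^-1 *: block_mx_of R t).
  split=> [i j|i i' ii'|m1 i]; first by rewrite !mxE mulr_ge0 ?invr_ge0.
    rewrite !block_sumZ !block_sum_mx_of -mulrDr -natrD (le_trans _ q1) //.
    by rewrite ler_wpM2l ?invr_ge0 // ler_nat tadj.
  rewrite !block_sumZ !block_sum_mx_of (le_trans _ q1) //.
  by rewrite ler_wpM2l ?invr_ge0 // ler_nat t1.
rewrite scalerA; apply/matrixP => i j; rewrite !mxE.
(* For [q = 0] rescaling loses the point, but all entries lie in ['I_1] and vanish. *)
have [q0|q0] := eqVneq q 0%N; last by rewrite mulfV ?mul1r // pnatr_eq0.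
have -> : tnth (tnth t i) j = 0%N :> nat.
  by apply/eqP; rewrite -leqn0 -ltnS -[X in (_ < X.+1)%N]q0 ltn_ord.
by rewrite mulr0.
Qed.

Definition block_paths (a m q : nat) : {set m.-tuple (a.-tuple 'I_q.+1)} :=
  [set t : m.-tuple (a.-tuple 'I_q.+1) | path block_adj (nseq_tuple a ord0) t].

(** Every block sum is at most [q], so the coordinates of a lattice point are integers between 0 and
    [q] and fit in ['I_q.+1]. *)
Lemma lattice_points_block_mx_of (R : realType) (a m q : nat) :
  (dilate R q (path_block_polytope R a m.+1) `&` lattice R m.+1 a)%classic =
  [set` [fset block_mx_of R t | t in block_paths a m.+1 q]%fset]%classic.
Proof.
apply/seteqP; split=> x /=; last first.
  move=> /imfsetP[t /=]; rewrite inE => tP ->; split; first exact/dilate_path_block_polytopeP.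
  by move=> i j; rewrite mxE rpred_nat.
move=> [xP xint].
have [x_ge0 x_le] : (forall i j, 0 <= x i j) /\ (forall i, block_sum R x i <= q%:R).
  case: xP => y [y_ge0 yadj y1] <-; split=> [i j|i]; first by rewrite mxE mulr_ge0.
  have ysum_ge0 k : 0 <= block_sum R y k by exact: sumr_ge0.
  rewrite block_sumZ ler_piMr //.
  (* A block other than the last is bounded through its successor, the last one through its
     predecessor, and a single block by its own constraint. *)
  have [i_max|i_lt] := eqVneq i ord_max; last first.
    have im : (i.+1 < m.+1)%N by rewrite ltnS ltn_neqAle -ltnS ltn_ord andbT.
    by apply: le_trans (yadj i (Ordinal im) erefl); rewrite lerDl.
  case: m i y i_max yadj y1 {x xint y_ge0} ysum_ge0 => [|m] i y i_max yadj y1 ysum_ge0.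
    exact: y1.
  have mm : (m < m.+2)%N by rewrite ltnS leqnSn.
  apply: le_trans (yadj (Ordinal mm) i _); last by rewrite i_max.
  by rewrite lerDr.
have x_leq i j : x i j <= q%:R.
  apply: le_trans (x_le i); rewrite /block_sum (bigD1 j) //= lerDl.
  by apply: sumr_ge0.
pose t := [tuple [tuple inord (Num.truncn (x i j)) : 'I_q.+1 | j < a] | i < m.+1].
have tx : x = block_mx_of R t.
  apply/matrixP => i j; rewrite mxE !tnth_mktuple.
  have xnat : (Num.truncn (x i j))%:R = x i j.
    by apply/eqP; rewrite -natrEtruncn natrEint xint x_ge0.
  by rewrite inordK ?xnat // ltnS -(ler_nat R) xnat.
by apply/imfsetP; exists t => //=; rewrite inE; apply/(dilate_path_block_polytopeP R); rewrite -tx.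
Qed.

Lemma lattice_countE (R : realType) (a m q : nat) : (0 < a)%N ->
  (lattice_count R a m.+1 q)%:Z =
    (weight_row a q *m transfer_mx a q ^+ m *m (const_mx 1 : 'cV_q.+1)) ord0 ord0.
Proof.
move=> a_gt0; rewrite /lattice_count lattice_points_block_mx_of set_fsetK.
rewrite card_imfset /=; last exact: block_mx_of_inj.
rewrite -cardE (@card_block_path a q m.+1 _ ord0) //; last first.
  by rewrite /block_size big_tuple big1 // => j _; rewrite tnth_nseq.
(* Row 0 of the transfer matrix is the weight row, so the step leaving the zero vector turns one
   factor into [weight_row]. *)
rewrite exprS -!mulmxA !mxE; apply: eq_bigr => s _.
by rewrite !mxE add0n -ltnS ltn_ord.
Qed.

(** * Admissible sets and the denominator *)

Lemma enum_val_ord_mono (n : nat) (S : {set 'I_n}) (i j : 'I_#|S|) :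
  (i <= j)%N -> (enum_val i <= enum_val j)%N.
Proof.
move=> ij; have x0 : 'I_n := enum_val i.
rewrite !(enum_val_nth x0) -!(nth_map x0 0%N val) -?cardE ?ltn_ord //.
have sorted_S : sorted leq [seq val x | x <- enum S].
  apply: (subseq_sorted leq_trans (s2 := iota 0 n)); last exact: iota_sorted.
  by rewrite -val_enum_ord map_subseq // enumT filter_subseq.
by apply: (sorted_leq_nth leq_trans leqnn) => //; rewrite inE size_map -cardE.
Qed.

(** Initial segments are nested, so comparing [p] with the segment below [j], of size [j], decides
    membership of [j]. *)
Lemma down_closed_ordE (k : nat) (p : pred 'I_k) :
    (forall i j : 'I_k, (i <= j)%N -> p j -> p i) ->
  forall j, p j = (j < #|p|)%N.
Proof.
move=> p_down j; have card_lt : #|[pred i : 'I_k | i < j]%N| = j.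
  by rewrite -sum1_card (big_ord_narrow (ltnW (ltn_ord j))) /= sum_nat_const card_ord muln1.
have [pj|pNj] := boolP (p j); apply/esym; last first.
  apply/negbTE; rewrite -leqNgt -[leqRHS]card_lt; apply/subset_leq_card/fintype.subsetP => i.
  by rewrite inE ltnNge => pi; apply: contra pNj => /p_down; apply.
rewrite -[ltnLHS]card_lt; apply/proper_card/fintype.properP; split.
  by apply/fintype.subsetP => i; rewrite inE => /ltnW /p_down; apply.
by exists j => //; rewrite inE ltnn.
Qed.

Lemma rhoE (q : nat) (S : {set 'I_q.+1}) (i j : 'I_#|S|) :
  (enum_val i + enum_val j <= q)%N = (j < rho S i)%N.
Proof.
rewrite (@down_closed_ordE _ (fun j : 'I_#|S| => enum_val i + enum_val j <= q)%N).
  congr (_ < _)%N; rewrite /rho -[LHS]sum1_card -[RHS]sum1dep_card.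
  rewrite [RHS]big_mkcondr /= [RHS]big_enum_val -[RHS]big_mkcond /=.
  by apply: eq_bigl => s; rewrite unfold_in.
by move=> r s rs; apply: leq_trans; rewrite leq_add2l enum_val_ord_mono.
Qed.

Lemma rho_anti (q : nat) (S : {set 'I_q.+1}) (i j : 'I_#|S|) :
  (i <= j)%N -> (rho S j <= rho S i)%N.
Proof.
move=> ij; apply/subset_leq_card/fintype.subsetP => t; rewrite !inE => /andP[-> /=].
by apply: leq_trans; rewrite leq_add2r enum_val_ord_mono.
Qed.

Lemma rho_le_card (q : nat) (S : {set 'I_q.+1}) (i : 'I_#|S|) :
  (rho S i <= #|S|)%N.
Proof. by apply/subset_leq_card/fintype.subsetP => t; rewrite inE => /andP[]. Qed.

Lemma det_transfer_minor (a q : nat) (S : {set 'I_q.+1}) :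
  \det (mxsub (@enum_val _ (mem S)) (@enum_val _ (mem S))
          (- ('X *: map_mx polyC (transfer_mx a q)))) =
  if admissible S then
    (-1) ^+ (#|S| * #|S|.+1 %/ 2) * 'X^#|S| * \prod_(s in S) (block_weight a s)%:R
  else 0.
Proof.
pose F : 'M[{poly int}]_#|S| := \matrix_(i, j) (j < rho S i)%N%:R.
pose d : 'rV[{poly int}]_#|S| :=
  \row_j (- 'X * (block_weight a (@enum_val _ (mem S) j))%:R).
(* The factor [- 'X] and the weight depend only on the column and can be pulled out. *)
rewrite (_ : mxsub _ _ _ = F *m diag_mx d); last first.
  apply/matrixP => i j; rewrite mul_mx_diag !mxE rhoE.
  by case: ifP => _; rewrite ?mulr0 ?oppr0 ?mul0r // mul1r mulNr -natz polyC_natr.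
rewrite det_mulmx det_diag det_ferrers; [|exact: rho_anti|exact: rho_le_card].
rewrite (_ : [forall i, _] = admissible S); last first.
  by apply: eq_forallb => i; rewrite addn1 subSS.
case: ifP => _; last by rewrite mul0r.
under [X in _ * X]eq_bigr do rewrite mxE.
rewrite big_split prodr_const card_ord [in RHS]big_enum_val /=.
rewrite (exprNn 'X) !mulrA -exprD; congr (_ ^+ _ * _ * _).
(* With k = #|S|, the k column signs and the staircase sign combine by k + C(k,2) = C(k+1,2). *)
by rewrite !divn2 -bin2 [in RHS]mulnC -(bin2 _.+1) binS bin1 addnC.
Qed.

Lemma visible_denominatorE (a q : nat) :
  visible_denominator a q =
    \sum_(k < q.+2)
      (-1) ^+ (k * k.+1 %/ 2) * 'X^k *
      \sum_(S : {set 'I_q.+1} | (#|S| == k) && admissible S)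
        \prod_(s in S) (block_weight a s)%:R.
Proof.
rewrite /visible_denominator /char_transfer_mx det_add1_minors.
under eq_bigr do rewrite det_transfer_minor.
rewrite -big_mkcond /=.
have S_lt (S : {set 'I_q.+1}) : (#|S| < q.+2)%N by rewrite ltnS -[leqRHS]card_ord max_card.
rewrite (partition_big (fun S => Ordinal (S_lt S)) xpredT) //=.
apply: eq_bigr => k _; rewrite mulr_sumr.
apply: eq_big => S; first by rewrite andbC.
by move=> /andP[_ /eqP <-].
Qed.

(** * The numerator through the adjugate *)

Lemma det_char_transfer_neq0 (a q : nat) : \det (char_transfer_mx a q) != 0.
Proof.
apply/eqP => d0; have := visible_denominator0 a q.
by rewrite /visible_denominator d0 horner0.
Qed.

(* Comparing coefficients in adj(I - yC) (I - yC) = det(I - yC) I gives the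
   recursion N_n = N_{n-1} C + d_n, solved by N_n = sum_i d_i C^(n-i). *)
Lemma coef_adj_char_transfer (a q n : nat) :
  map_mx (coefp n) (\adj (char_transfer_mx a q)) =
    \sum_(i < n.+1) (visible_denominator a q)`_i *: transfer_mx a q ^+ (n - i).
Proof.
set N := \adj _; set C := transfer_mx a q; set D := visible_denominator a q.
have ND : N = D%:M + 'X *: (N *m map_mx polyC C).
  rewrite -mul_adj_mx -/N /char_transfer_mx mulmxBr mulmx1 -scalemxAr.
  by rewrite subrK.
have NC k : map_mx (coefp k) (N *m map_mx polyC C) = map_mx (coefp k) N *m C.
  apply/matrixP => i j; rewrite !mxE /= coef_sum.
  by apply: eq_bigr => s _; rewrite !mxE coefMC.
elim: n => [|n IHn].
  rewrite big_ord1 expr0 ND; apply/matrixP => i j; rewrite !mxE /=.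
  by rewrite coefD coefXM addr0 coefMn mulr_natr.
rewrite ND; transitivity ((D`_n.+1)%:M + map_mx (coefp n) N *m C).
  rewrite -NC; apply/matrixP => i j; rewrite !mxE /=.
  by rewrite coefD coefXM coefMn.
rewrite IHn [RHS]big_ord_recr /= subnn expr0 [LHS]addrC -scalemx1; congr (_ + _).
rewrite mulmx_suml; apply: eq_bigr => i _.
by rewrite -scalemxAl subSn ?exprSr // -ltnS.
Qed.

(** Sandwiching the coefficient formula for the adjugate between the weight row and the ones column
    turns each power of the transfer matrix into a lattice count, which yields the convolution
    defining the numerator. *)
Lemma visible_numeratorE (R : realType) (a q : nat) : (0 < a)%N ->
  visible_numerator R a q =1
    fps_of_poly
      ((weight_row_poly a q *m \adj (char_transfer_mx a q) *m ones_col q) ord0 ord0).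
Proof.
move=> a_gt0 n; rewrite /visible_numerator /fps_mul /fps_of_poly /path_series.
transitivity ((weight_row a q *m map_mx (coefp n) (\adj (char_transfer_mx a q))
                 *m (const_mx 1 : 'cV_q.+1)) ord0 ord0).
  rewrite coef_adj_char_transfer mulmx_sumr mulmx_suml summxE.
  by apply: eq_bigr => i _; rewrite lattice_countE // -scalemxAr -scalemxAl [RHS]mxE.
rewrite !mxE coef_sum; apply: eq_bigr => i _; rewrite !mxE !mulr1 coef_sum.
by apply: eq_bigr => j _; rewrite !mxE coefCM.
Qed.

Theorem theorem1p3 (R : realType) (a q : nat) (ha : (1 <= a)%N) :
  [/\ visible_denominator a q = \det (char_transfer_mx a q),
      visible_numerator R a q =1
        fps_of_poly
          ((weight_row_poly a q *m \adj (char_transfer_mx a q) *m ones_col q)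
             ord0 ord0),
      visible_numerator R a q =1
        fps_of_poly
          (\det (char_transfer_mx a q + ones_col q *m weight_row_poly a q)
           - \det (char_transfer_mx a q))
    & visible_denominator a q =
        \sum_(k < q.+2)
          (-1) ^+ (k * k.+1 %/ 2) * 'X^k *
          \sum_(S : {set 'I_q.+1} | (#|S| == k) && admissible S)
            \prod_(s in S) ('C(s + a - 1, a - 1))%:R ].
Proof.
split; [by [] | exact: visible_numeratorE | | exact: visible_denominatorE].
rewrite det_add_rank1 ?det_char_transfer_neq0 // addrC addKr.
exact: visible_numeratorE.
Qed.
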